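(* Let $k \ge 4$ be an integer and let $(x,t)$ be a pair of positive integers. For every $n \in \mathcal{D}_{x,t}^{(k)}$ we have \[ F_{x,t}^{(k)}(n) = t^2(kx-n)^2 - 2nxt \ge 0. \] Moreover, for all $n_1, n_2 \in \mathcal{D}_{x,t}^{(k)}$ with $n_1 > n_2$ we have \[ F_{x,t}^{(k)}(n_1) < F_{x,t}^{(k)}(n_2), \] i.e. $n \mapsto F_{x,t}^{(k)}(n)$ is strictly decreasing on $\mathcal{D}_{x,t}^{(k)}$.
   Context: Fix an integer $N_1 \ge 2$. For an integer $k \ge 4$ and positive integers $x,t$, define for natural numbers $n$ \[ F_{x,t}^{(k)}(n) = t^2(kx-n)^2 - 2nxt, \] and define the admissible domain of the pair $(x,t)$ by \[ \mathcal{D}_{x,t}^{(k)} = \left\{ n \in \mathbb{N},\ n \ge N_1 \ \middle|\ n < kx \ \text{and}\ t \ge \frac{2nx}{(kx-n)^2} \right\}. \] *)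

(* Defs.v *)
From mathcomp Require Import all_boot all_order all_algebra.

Set Implicit Arguments.
Unset Strict Implicit.
Unset Printing Implicit Defensive.

Import Order.TTheory GRing.Theory Num.Theory.
Local Open Scope ring_scope.

(* Values are taken in int, since subtraction on nat is truncated. *)
Definition F (k x t n : nat) : int :=
  t%:Z ^+ 2 * (k%:Z * x%:Z - n%:Z) ^+ 2 - 2 * n%:Z * x%:Z * t%:Z.

(* The quotient is the exact one, in rat; its denominator is nonzero because
   n < k * x. *)
Definition admissible (N1 k x t : nat) : {pred nat} :=
  [pred n : nat | [&& (N1 <= n)%N, (n < k * x)%N &
     2 * n%:R * x%:R / (k%:R * x%:R - n%:R) ^+ 2 <= t%:R :> rat]].

(* Main.v *)
Require Import Defs.
From mathcomp Require Import all_boot all_order all_algebra.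
From mathcomp Require Import ring.

Set Implicit Arguments.
Unset Strict Implicit.
Unset Printing Implicit Defensive.

Import Order.TTheory GRing.Theory Num.Theory.
Local Open Scope ring_scope.

(** Nonnegativity comes from the factorisation [F k x t n] = t * (t(kx-n)^2 - 2nx): the second
    factor is nonnegative exactly when the admissibility inequality, cleared of its denominator,
    holds ([admissible_int_le]). Monotonicity uses only n < kx: as n grows, kx-n stays positive and
    shrinks, so t^2(kx-n)^2 strictly drops, while the subtracted 2nxt does not decrease. *)

Lemma admissible_ltn (N1 k x t n : nat) :
  n \in admissible N1 k x t -> n%:Z < k%:Z * x%:Z.
Proof. by rewrite inE => /and3P[_ ltn _]; rewrite -PoszM ltz_nat. Qed.

(** Since n < kx, the denominator is positive and can be cleared in [rat]; the embedding of [int]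
    into [rat] reflects the order. *)
Lemma admissible_int_le (N1 k x t n : nat) :
  n \in admissible N1 k x t ->
  2 * n%:Z * x%:Z <= t%:Z * (k%:Z * x%:Z - n%:Z) ^+ 2.
Proof.
move=> adm; have ltn := admissible_ltn adm.
move: adm; rewrite inE => /and3P[_ _].
rewrite ler_pdivrMr => [le_rat|].
  by rewrite -(ler_int rat) !(rmorphM, rmorphXn, rmorphB).
rewrite exprn_gt0 // subr_gt0.
by move: ltn; rewrite -(ltr_int rat) rmorphM.
Qed.

Theorem proposition1 (N1 : nat) (hN1 : (2 <= N1)%N) (k : nat) (hk : (4 <= k)%N)
    (x t : nat) (hx : (0 < x)%N) (ht : (0 < t)%N) :
  (forall n : nat, n \in admissible N1 k x t -> 0 <= F k x t n) /\
  (forall n1 n2 : nat,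
      n1 \in admissible N1 k x t -> n2 \in admissible N1 k x t ->
      (n2 < n1)%N -> F k x t n1 < F k x t n2).
Proof.
split=> [n adm | n1 n2 adm1 adm2 lt21].
  have -> : F k x t n =
      t%:Z * (t%:Z * (k%:Z * x%:Z - n%:Z) ^+ 2 - 2 * n%:Z * x%:Z).
    by rewrite /F; ring.
  by rewrite mulr_ge0 // subr_ge0 (admissible_int_le adm).
have ltn1 := admissible_ltn adm1.
have lt21Z : n2%:Z < n1%:Z by rewrite ltz_nat.
(* Strictness comes from the squares: n2 < n1 < kx keeps both bases in the range where squaring is
   increasing. The linear terms need only a weak comparison. *)
apply: ltr_leB.
  rewrite ltr_pM2l ?exprn_gt0 ?ltz_nat //.
  by rewrite ltrXn2r //= ?ltrD2l ?ltrN2 // subr_ge0 ltW // (lt_trans lt21Z).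
by rewrite !ler_wpM2r // ler_wpM2l // ltW.
Qed.
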